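(* Let $G=(V,E)$ be a simple undirected graph with $n$ vertices and $m$ edges, let $s\ge1$, $\varepsilon>0$, $\delta\in(0,1)$, and let $r,q$ be positive integers satisfying $$r\ \ge\ \frac{30\cdot n\cdot\sum_{v\in V}\mathrm{wt}(v)^2}{\varepsilon^2\cdot\delta\cdot\mu_s^2}\qquad\text{and}\qquad q\ \ge\ \frac{2000\cdot m\cdot\mu_{2s-1}}{\varepsilon^2\cdot\delta^3\cdot\mu_s^2}.$$ Then the value $X$ returned by $\mathrm{Approx}_s(r,q)$ on $G$ satisfies $X\in[(1-\varepsilon)\bar\mu_s,(1+\varepsilon)\bar\mu_s]$ with probability at least $1-\delta$, where $\bar\mu_s=\mu_s/n$.
   Context: $d_v$ is the degree of $v$, $\Gamma(v)$ its neighbor set; vertices have distinct identifiers $id(\cdot)$. For real $t$, $\mu_t=\sum_{v\in V}d_v^t$. Degree ordering: $u\prec v$ iff $d_u<d_v$, or $d_u=d_v$ and $id(u)<id(v)$. For an ordered pair $e=(v,u)$ with $u\in\Gamma(v)$: $\mathrm{wt}(e)=d_v^{s-1}+d_u^{s-1}$ if $v\prec u$, and $0$ otherwise; $\mathrm{wt}(v)=\sum_{u\in\Gamma(v)}\mathrm{wt}((v,u))$. Algorithm $\mathrm{Approx}_s(r,q)$: (1) Select $r$ vertices uniformly, independently at random; let $R$ be the resulting multiset, query the degree of each vertex in $R$, and let $d_R=\sum_{v\in R}d_v$. (2) For $i=1,\dots,q$: select an element $v_i$ of $R$ with probability $d_{v_i}/d_R$ (proportional to degree, counting multiplicities), and query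 a uniformly random neighbor $u_i$ of $v_i$; if $v_i\prec u_i$ set $X_i=d_{v_i}^{s-1}+d_{u_i}^{s-1}$, else $X_i=0$. (3) Return $X=\frac1r\cdot\frac{d_R}{q}\cdot\sum_{i=1}^qX_i$. *)

(* Defs.v *)
From mathcomp Require Import all_boot all_order all_algebra.
From mathcomp Require Import reals exp.

Set Implicit Arguments.
Unset Strict Implicit.
Unset Printing Implicit Defensive.

Import Order.TTheory GRing.Theory Num.Theory.
Local Open Scope ring_scope.

(* Finitely supported weighted sampling, with outcomes in an arbitrary type:
   a law is the list of its (weight, outcome) pairs, repetitions allowed. It is
   a probability law when the weights are nonnegative and add up to 1. *)
Section Laws.
Variable R : realType.

Definition law (T : Type) := seq (R * T).

Definition nonneg T (p : law T) : bool := all (fun px => 0 <= px.1) p.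

Definition mass T (p : law T) : R := \sum_(px <- p) px.1.

Definition is_probability T (p : law T) : Prop := nonneg p /\ mass p = 1.

Definition Prob T (p : law T) (E : pred T) : R := \sum_(px <- p | E px.2) px.1.

Definition lret T (x : T) : law T := [:: (1, x)].

Definition lbind T U (p : law T) (f : T -> law U) : law U :=
  [seq (px.1 * qy.1, qy.2) | px <- p, qy <- f px.2].

(* An entry of l, chosen with probability proportional to w; entries are
   counted with multiplicity. Meaningful when w has a positive total on l. *)
Definition draw T (w : T -> R) (l : seq T) : law T :=
  [seq (w x / \sum_(y <- l) w y, x) | x <- l].

Definition uniform T (l : seq T) : law T := draw (fun=> 1) l.

Fixpoint iid T (n : nat) (p : law T) : law (seq T) :=
  if n is n'.+1
  then lbind p (fun x => lbind (iid n' p) (fun l => lret (x :: l)))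
  else lret [::].

End Laws.

(* A simple graph is a finite type V with an adjacency relation adj that the
   theorem assumes symmetric and irreflexive. *)
Section Graph.
Variables (R : realType) (V : finType) (adj : rel V) (ident : V -> nat).

Definition nbrs (v : V) : {set V} := [set u | adj v u].

Definition deg (v : V) : nat := #|nbrs v|.

Definition edges : {set {set V}} :=
  [set [set vu.1; vu.2] | vu : V * V & adj vu.1 vu.2].

Definition prec (u v : V) : bool :=
  (deg u < deg v)%N || (deg u == deg v) && (ident u < ident v)%N.

(* With powR, 0 `^ t = 0 for t != 0 and 0 `^ 0 = 1, so isolated vertices do not
   contribute to mu t for t >= 1. *)
Definition mu (t : R) : R := \sum_(v : V) (deg v)%:R `^ t.

Definition mubar (t : R) : R := mu t / #|V|%:R.

Definition wt_pair (s : R) (v u : V) : R :=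
  if prec v u then (deg v)%:R `^ (s - 1) + (deg u)%:R `^ (s - 1) else 0.

Definition wt (s : R) (v : V) : R := \sum_(u in nbrs v) wt_pair s v u.

(* The law of one X_i, given the sampled multiset Rs. *)
Definition sampleX (s : R) (Rs : seq V) : law R R :=
  lbind (draw (fun v => (deg v)%:R) Rs) (fun v =>
  lbind (uniform R (enum (nbrs v))) (fun u =>
  lret R (wt_pair s v u))).

(* The law of the value returned by Approx_s(r, q). If only isolated vertices
   were sampled, then d_R = 0 and no v_i can be drawn; the returned value is
   then 0, in accordance with the factor d_R of the output formula. *)
Definition approx (s : R) (r q : nat) : law R R :=
  lbind (iid r (uniform R (enum V))) (fun Rs =>
  let dR : R := \sum_(v <- Rs) (deg v)%:R in
  if dR == 0 then lret R 0 else
  lbind (iid q (sampleX s Rs)) (fun Xs =>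
  lret R (1 / r%:R * (dR / q%:R) * \sum_(X <- Xs) X))).

End Graph.

Section ApproxIsProbability.
Variable R : realType.

Lemma nonneg_lbind T U (p : law R T) (f : T -> law R U) :
  nonneg p -> (forall x, nonneg (f x)) -> nonneg (lbind p f).
Proof.
move=> + f0; elim: p => //= px p IH /andP[px0 /IH{}IH].
rewrite /nonneg /lbind /= all_cat [X in _ && X]IH andbT all_map.
by apply: sub_all (f0 px.2) => qy /= qy0; rewrite mulr_ge0.
Qed.

Lemma mass_lret T (x : T) : mass (lret R x) = 1.
Proof. by rewrite /mass big_seq1. Qed.

Lemma mass_lbind T U (p : law R T) (f : T -> law R U) :
  mass (lbind p f) = \sum_(px <- p) px.1 * mass (f px.2).
Proof.
rewrite /mass /lbind big_allpairs_dep /=; apply: eq_bigr => px _.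
by rewrite mulr_sumr.
Qed.

Lemma mass_lbind1 T U (p : law R T) (f : T -> law R U) :
  (forall x, mass (f x) = 1) -> mass (lbind p f) = mass p.
Proof. by move=> f1; rewrite mass_lbind; under eq_bigr do rewrite f1 mulr1. Qed.

Lemma nonneg_draw T (w : T -> R) (l : seq T) :
  (forall x, 0 <= w x) -> nonneg (draw w l).
Proof.
move=> w0; rewrite /nonneg /draw all_map; apply: (@sub_all _ predT) => [x _|].
  by rewrite /= divr_ge0 ?sumr_ge0.
exact: all_predT.
Qed.

Lemma mass_draw T (w : T -> R) (l : seq T) :
  \sum_(x <- l) w x != 0 -> mass (draw w l) = 1.
Proof. by move=> w0; rewrite /mass /draw big_map -mulr_suml divff. Qed.

Lemma nonneg_iid T n (p : law R T) : nonneg p -> nonneg (iid n p).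
Proof.
move=> p0; elim: n => [|n IH] /=; first by rewrite /nonneg /= ler01.
by do 2!apply: nonneg_lbind => // ?; rewrite /nonneg /= ler01.
Qed.

Lemma mass_iid T n (p : law R T) : mass p = 1 -> mass (iid n p) = 1.
Proof.
move=> p1; elim: n => [|n IH] /=; first exact: mass_lret.
by rewrite !mass_lbind1 // => x; rewrite mass_lbind1 // => l; apply: mass_lret.
Qed.

Lemma mass_uniform T (l : seq T) : (0 < size l)%N -> mass (uniform R l) = 1.
Proof.
move=> l0; rewrite mass_draw // big_const_seq count_predT iter_addr addr0.
by rewrite pnatr_eq0 -lt0n.
Qed.

Variables (V : finType) (adj : rel V) (ident : V -> nat).

Lemma approx_probability (s : R) (r q : nat) :
  (0 < #|V|)%N -> is_probability (approx adj ident s r q).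
Proof.
move=> V0.
have ret0 T (x : T) : nonneg (lret R x) by rewrite /nonneg /= ler01.
have uni0 T (l : seq T) : nonneg (uniform R l).
  by apply: nonneg_draw => ?; apply: ler01.
split.
  apply: nonneg_lbind => [|Rs /=]; first exact: nonneg_iid.
  case: ifP => [_|_]; first exact: ret0.
  apply: nonneg_lbind => [|Xs]; [apply: nonneg_iid | exact: ret0].
  apply: nonneg_lbind => [|v]; first by apply: nonneg_draw => v; apply: ler0n.
  exact: nonneg_lbind.
rewrite mass_lbind1 => [|Rs /=].
  by rewrite mass_iid // mass_uniform // -cardE.
case: ifPn => [_|dR0]; first exact: mass_lret.
rewrite mass_lbind1 => [|Xs]; last exact: mass_lret.
apply: mass_iid; rewrite mass_lbind -[RHS](mass_draw dR0).
rewrite /mass !big_map; apply: eq_bigr => v _ /=.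
have [->|dv0] := eqVneq (deg adj v) 0%N; first by rewrite mul0r mul0r.
rewrite -[X in _ * X]/(mass _) mass_lbind1 => [|u]; last exact: mass_lret.
by rewrite mass_uniform ?mulr1 // -cardE lt0n.
Qed.

End ApproxIsProbability.

(* Main.v *)
(* Conditionally on the sample Rs, the estimate X has mean W / r and variance at
   most D * Q / (r ^ 2 * q), where W, D and Q are the sums over Rs of the weights,
   the degrees and the squared pair weights. Chebyshev keeps W / r within
   eps / 2 * mubar of mubar with failure probability 4 / 30 * delta; Markov keeps
   D and Q below 5 / delta times their mean bounds, each with failure probability
   delta / 5; given these, a second Chebyshev keeps X within eps / 2 * mubar of
   W / r with failure probability delta / 5. The means are controlled by charging
   every edge to its smaller endpoint in the degree ordering. *)

Require Import Defs.
From mathcomp Require Import all_boot all_order all_algebra.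
From mathcomp Require Import reals exp.
From mathcomp Require Import ring lra.

Set Implicit Arguments.
Unset Strict Implicit.
Unset Printing Implicit Defensive.

Import Order.TTheory GRing.Theory Num.Theory.
Local Open Scope ring_scope.

(** * Expectation, Markov and Chebyshev inequalities for finite laws *)

Section Expectation.
Variable R : realType.

Definition expect T (p : law R T) (f : T -> R) : R :=
  \sum_(px <- p) px.1 * f px.2.

Lemma expect_lret T (x : T) f : expect (lret R x) f = f x.
Proof. by rewrite /expect big_seq1 mul1r. Qed.

Lemma expect_lbind T U (p : law R T) (k : T -> law R U) f :
  expect (lbind p k) f = expect p (fun x => expect (k x) f).
Proof.
rewrite /expect /lbind big_allpairs_dep /=; apply: eq_bigr => px _.
by rewrite mulr_sumr; apply: eq_bigr => qy _; rewrite mulrA.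
Qed.

Lemma eq_expect T (p : law R T) f g : f =1 g -> expect p f = expect p g.
Proof. by move=> fg; apply: eq_bigr => px _; rewrite fg. Qed.

Lemma ler_expect T (p : law R T) f g :
  nonneg p -> (forall x, f x <= g x) -> expect p f <= expect p g.
Proof.
move=> p0 fg; elim: p p0 => [|px p IH] /=; first by rewrite /expect !big_nil.
move=> /andP[px0 /IH]; rewrite /expect !big_cons => h.
by apply: lerD => //; apply: ler_wpM2l.
Qed.

Lemma expectD T (p : law R T) f g :
  expect p (fun x => f x + g x) = expect p f + expect p g.
Proof. by rewrite /expect -big_split; apply: eq_bigr => px _; rewrite mulrDr. Qed.

Lemma expectZ T (p : law R T) a f :
  expect p (fun x => a * f x) = a * expect p f.
Proof. by rewrite /expect mulr_sumr; apply: eq_bigr => px _; rewrite mulrCA. Qed.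

Lemma expect_cst T (p : law R T) a : mass p = 1 -> expect p (fun=> a) = a.
Proof. by move=> p1; rewrite /expect -mulr_suml -[X in X * _]/(mass p) p1 mul1r. Qed.

Lemma ProbE T (p : law R T) (A : pred T) :
  Prob p A = expect p (fun x => (A x)%:R).
Proof.
rewrite /Prob /expect big_mkcond; apply: eq_bigr => px _.
by case: (A px.2); rewrite ?mulr1 ?mulr0.
Qed.

Lemma ProbC T (p : law R T) (A : pred T) :
  Prob p (predC A) = mass p - Prob p A.
Proof. by rewrite /mass [in RHS](bigID (fun px => A px.2)) /= [X in X - _]addrC addrK. Qed.

Lemma Prob_le1 T (p : law R T) (A : pred T) : is_probability p -> Prob p A <= 1.
Proof.
move=> [p0 p1]; rewrite ProbE -[X in _ <= X](expect_cst 1 p1).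
by apply: ler_expect => // x; rewrite lern1 leq_b1.
Qed.

Lemma markov T (p : law R T) (f : T -> R) (A : pred T) (t : R) :
  nonneg p -> (forall x, 0 <= f x) -> (forall x, A x -> t <= f x) ->
  t * Prob p A <= expect p f.
Proof.
move=> p0 f0 fA; rewrite ProbE -expectZ; apply: ler_expect => // x.
by case: (boolP (A x)) => [/fA|_]; rewrite ?mulr1 ?mulr0.
Qed.

Lemma chebyshev T (p : law R T) (f : T -> R) (c t : R) :
  nonneg p -> 0 <= t ->
  t ^+ 2 * Prob p (fun x => t < `|f x - c|) <=
  expect p (fun x => (f x - c) ^+ 2).
Proof.
move=> p0 t0; apply: markov => // x; first exact: sqr_ge0.
by move=> /ltW; rewrite -ler_sqr ?nnegrE // real_normK ?num_real.
Qed.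

Lemma expect_iid_sum T n (p : law R T) (f : T -> R) : mass p = 1 ->
  expect (iid n p) (fun l => \sum_(x <- l) f x) = n%:R * expect p f.
Proof.
move=> p1; elim: n => [|n IH] /=; first by rewrite expect_lret big_nil mul0r.
rewrite expect_lbind.
under eq_expect => x.
  rewrite expect_lbind; under eq_expect do rewrite expect_lret big_cons.
  rewrite expectD IH expect_cst ?mass_iid //.
  over.
by rewrite expectD expect_cst //; ring.
Qed.

(** Variances of independent draws add: peeling off one draw leaves a cross term that averages to
    zero, because the remaining sum has mean [n%:R * c]. *)
Lemma variance_iid_sum T n (p : law R T) (f : T -> R) : mass p = 1 ->
  expect (iid n p) (fun l => (\sum_(x <- l) f x - n%:R * expect p f) ^+ 2) =
  n%:R * (expect p (fun x => f x ^+ 2) - expect p f ^+ 2).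
Proof.
move=> p1; set c := expect p f.
elim: n => [|n IH] /=; first by rewrite expect_lret big_nil !mul0r subr0 expr0n.
rewrite expect_lbind.
under eq_expect => x.
  rewrite expect_lbind; under eq_expect => l.
    rewrite expect_lret big_cons.
    (* The square is expanded around the centred tail sum, so that the first summand is the
       induction hypothesis and the second is linear in the tail. *)
    rewrite (_ : _ ^+ 2 = (\sum_(x <- l) f x - n%:R * c) ^+ 2
       + (2 * (f x - c) * (\sum_(x <- l) f x)
       + ((f x - c) ^+ 2 - 2 * (f x - c) * (n%:R * c)))); last first.
      by ring.
    over.
  rewrite expectD IH expectD expectZ expect_iid_sum // expect_cst ?mass_iid //.
  rewrite -/c.
  rewrite (_ : n%:R * _ + _ = f x ^+ 2 + (- (2 * c) * f x + (c ^+ 2 +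
    n%:R * (expect p (fun x => f x ^+ 2) - c ^+ 2)))); last by ring.
  over.
by rewrite expectD expectD expectZ expect_cst // -/c; ring.
Qed.

(** The variance of one draw is bounded by its second moment, the quantity that the later sections
    can estimate. *)
Lemma chebyshev_iid_sum T n (p : law R T) (f : T -> R) (t : R) :
  nonneg p -> mass p = 1 -> 0 <= t ->
  t ^+ 2 * Prob (iid n p) (fun l => t < `|\sum_(x <- l) f x - n%:R * expect p f|)
  <= n%:R * expect p (fun x => f x ^+ 2).
Proof.
move=> p0 p1 t0; apply: le_trans (chebyshev _ _ _ t0) _; first exact: nonneg_iid.
by rewrite variance_iid_sum // ler_wpM2l // lerBlDr lerDl sqr_ge0.
Qed.

Lemma expect_uniform (T : finType) (A : {set T}) (f : T -> R) :
  expect (uniform R (enum A)) f = (\sum_(x in A) f x) / #|A|%:R.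
Proof.
rewrite /expect big_map /= big_enum /= mulr_suml; apply: eq_bigr => x _.
by rewrite big_enum /= sumr_const div1r mulrC.
Qed.

Lemma uniform_probability (T : finType) (A : {set T}) :
  (0 < #|A|)%N -> is_probability (uniform R (enum A)).
Proof.
split; first by apply: nonneg_draw => ?; apply: ler01.
by rewrite mass_uniform // -cardE.
Qed.

End Expectation.

(** * Degree ordering and charging of edges to endpoints *)

Section DegreeOrder.
Variables (R : realType) (V : finType) (adj : rel V) (ident : V -> nat).
Hypotheses (adj_sym : symmetric adj) (adj_irr : irreflexive adj).
Hypothesis ident_inj : injective ident.

Local Notation prec := (prec adj ident).
Local Notation deg := (deg adj).
Local Notation nbrs := (nbrs adj).
Local Notation mu := (@mu R V adj).

Lemma prec_total u v : u != v -> prec u v = ~~ prec v u.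
Proof.
move=> uv; have : ident u != ident v by apply: contra_neq uv => /ident_inj.
rewrite /Defs.prec; case: (ltngtP (deg u) (deg v)) => //= _.
by case: ltngtP.
Qed.

(* Every edge is counted from its smaller endpoint, and hands [f] once to each
   of its two endpoints. *)
Lemma sum_prec (f : V -> R) :
  \sum_v \sum_(u in nbrs v) (if prec v u then f v + f u else 0) =
  \sum_v (deg v)%:R * f v.
Proof.
have -> : \sum_v \sum_(u in nbrs v) (if prec v u then f v + f u else 0) =
    \sum_v \sum_(u | adj v u) (prec v u)%:R * f v +
    \sum_v \sum_(u | adj v u) (prec v u)%:R * f u.
  rewrite -big_split /=; apply: eq_bigr => v _; rewrite -big_split /=.
  apply: eq_big => [u|u _]; first by rewrite inE.
  by case: ifP => _; rewrite ?mul1r // !mul0r addr0.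
(* Exchanging the two sums collects at [v] what its neighbours hand over. Each neighbour [u] then
   contributes [prec v u] plus [prec u v] times [f v], and exactly one of the two holds. *)
rewrite [X in _ + X](exchange_big_dep xpredT) //= -big_split /=.
apply: eq_bigr => v _; rewrite [X in _ + X](eq_bigl (adj v)); last first.
  by move=> u; rewrite adj_sym.
rewrite -big_split /= /deg -sum1_card natr_sum mulr_suml.
apply: eq_big => [u|u avu]; first by rewrite inE.
have uv : u != v by apply: contraTneq avu => ->; rewrite adj_irr.
by rewrite (prec_total uv) mul1r; case: (prec v u); rewrite !mul1r mul0r ?addr0 ?add0r.
Qed.

Lemma sum_wt (s : R) : 1 <= s -> \sum_v wt adj ident s v = mu s.
Proof.
move=> s1; rewrite sum_prec; apply: eq_bigr => v _.
by rewrite mulr_powRB1 //; lra.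
Qed.

(** Since [(x + y) ^+ 2 <= 2 * x ^+ 2 + 2 * y ^+ 2], a squared pair weight splits into one charge
    per endpoint, and [sum_prec] applies again. *)
Lemma sum_wt_pair_sqr (s : R) : 1 <= s ->
  \sum_v \sum_(u in nbrs v) wt_pair adj ident s v u ^+ 2 <= 2 * mu (2 * s - 1).
Proof.
move=> s1; pose f v : R := 2 * ((deg v)%:R `^ (s - 1)) ^+ 2.
apply: (@le_trans _ _
  (\sum_v \sum_(u in nbrs v) (if prec v u then f v + f u else 0))).
  apply: ler_sum => v _; apply: ler_sum => u _; rewrite /wt_pair /f.
  case: ifP => _; last by rewrite expr0n.
  set x := _ `^ _; set y := _ `^ _; have := sqr_ge0 (x - y); nra.
rewrite sum_prec mulr_sumr; apply: ler_sum => v _.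
rewrite /f mulrCA -powR_mulrn ?powR_ge0 // -powRrM.
rewrite (_ : (s - 1) * 2 = (2 * s - 1) - 1); last by ring.
by rewrite mulr_powRB1 //; lra.
Qed.

(** This is the handshake count: [sum_prec] with constant 1 gives 2 for each pair oriented upwards,
    and forgetting the orientation embeds these pairs into the edges. *)
Lemma sum_deg_le : \sum_v (deg v)%:R <= 2 * #|edges adj|%:R :> R.
Proof.
pose A := [set vu : V * V | adj vu.1 vu.2 && prec vu.1 vu.2].
have -> : \sum_v (deg v)%:R = 2 * #|A|%:R :> R.
  transitivity (\sum_v (deg v)%:R * (1 : R)).
    by apply: eq_bigr => v _; rewrite mulr1.
  rewrite -(sum_prec (fun=> 1)) -sum1_card natr_sum mulr_sumr.
  under eq_bigr do rewrite -big_mkcondr /=.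
  by rewrite pair_big_dep /=; apply: eq_big => [vu|vu _]; rewrite ?inE ?mulr1.
rewrite ler_wpM2l // ler_nat.
pose e (vu : V * V) := [set vu.1; vu.2].
rewrite -(@card_in_imset _ _ e A); last first.
  move=> [a b] [c d]; rewrite !inE /= => /andP[ab pab] /andP[cd pcd] /setP E.
  have nab : a != b by apply: contraTneq ab => ->; rewrite adj_irr.
  have ncd : c != d by apply: contraTneq cd => ->; rewrite adj_irr.
  (* Equal edges have equal or swapped endpoints. The swapped case contradicts [prec_total]; the
     other spurious cases would make an edge a loop. *)
  have := E a; have := E b; rewrite /e !inE /= !eqxx ?orbT /=.
  move=> /esym/orP[]/eqP eb /esym/orP[]/eqP ea; subst a b => //.
  - by rewrite eqxx in nab.
  - by move: pab; rewrite prec_total 1?eq_sym // pcd.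
  - by rewrite eqxx in nab.
by apply/subset_leq_card/subsetP => _ /imsetP[vu + ->]; rewrite inE => /andP[? _];
   apply/imsetP; exists vu; rewrite ?inE.
Qed.

Lemma mu_gt0 (t : R) : 0 < t -> (exists v, deg v != 0%N) -> 0 < mu t.
Proof.
move=> t0 [v dv]; rewrite /Defs.mu (bigD1 v) //= ltr_pwDl //.
  by rewrite powR_gt0 // ltr0n lt0n.
by apply: sumr_ge0 => u _; apply: powR_ge0.
Qed.

(** Drawing [v] with weight [deg v] and then a neighbour with weight [1 / deg v] makes the degree
    cancel: all pairs issuing from the sample are equally likely. *)
Lemma expect_sampleX (s : R) (Rs : seq V) (f : R -> R) :
  expect (sampleX adj ident s Rs) f =
  (\sum_(v <- Rs) \sum_(u in nbrs v) f (wt_pair adj ident s v u)) /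
  \sum_(v <- Rs) (deg v)%:R.
Proof.
rewrite /sampleX expect_lbind /expect big_map mulr_suml.
apply: eq_bigr => v _ /=.
rewrite -[X in _ * X]/(expect _ _) expect_lbind expect_uniform.
under [X in _ * (X / _)]eq_bigr do rewrite expect_lret.
(* For an isolated vertex both sides vanish: its inner sum is empty and the inverse of 0 is 0. *)
rewrite -/(deg v); have [d0|d0] := eqVneq (deg v) 0%N; last first.
  by rewrite [X in X * _]mulrC mulrACA divff ?pnatr_eq0 // mulr1 mulrC.
rewrite d0 invr0 !mulr0 [X in X / _]big1 ?mul0r // => u uv.
by move: d0 => /cards0_eq d0; rewrite d0 inE in uv.
Qed.

End DegreeOrder.

(** * Concentration of the vertex sample and of the estimate given the sample *)

Section Sampling.
Variables (R : realType) (V : finType) (adj : rel V) (ident : V -> nat).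
Hypotheses (adj_sym : symmetric adj) (adj_irr : irreflexive adj).
Hypothesis ident_inj : injective ident.
Variables (s eps delta : R) (r q : nat).
Hypotheses (s_ge1 : 1 <= s) (eps_gt0 : 0 < eps).
Hypothesis delta_gt0 : 0 < delta.
Hypotheses (V_gt0 : (0 < #|V|)%N) (r_gt0 : (0 < r)%N) (q_gt0 : (0 < q)%N).

Local Notation deg := (deg adj).
Local Notation nbrs := (nbrs adj).
Local Notation mu := (@mu R V adj).
Local Notation wt := (wt adj ident s).
Local Notation wt_pair := (wt_pair adj ident s).
Local Notation n := (#|V|%:R : R).
Local Notation M := (mubar adj s).
Local Notation sample := (iid r (uniform R (enum V))).

(** Summed over the sample and divided by its total degree, this is the second moment of one
    [X_i]. *)
Let wt2 (v : V) : R := \sum_(u in nbrs v) wt_pair v u ^+ 2.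

Lemma uniformV_probability : is_probability (uniform R (enum V)).
Proof.
have := @uniform_probability R V setT.
by rewrite cardsT enum_setT -enumT; apply.
Qed.

Lemma expect_uniformV f : expect (uniform R (enum V)) f = (\sum_v f v) / n.
Proof.
have := expect_uniform [set: V] f.
rewrite cardsT enum_setT -enumT => ->.
by congr (_ / _); apply: eq_bigl => v; rewrite inE.
Qed.

Lemma sample_nonneg : nonneg sample.
Proof. by apply: nonneg_iid; case: uniformV_probability. Qed.

(** The weight of a uniform vertex has mean [M] by [sum_wt]. In Chebyshev the halved deviation costs
    the factor 4, and the lower bound on [r] supplies the 30. *)
Lemma Prob_sample_wt : 0 < M ->
    r%:R >= 30 * n * (\sum_v wt v ^+ 2) / (eps ^+ 2 * delta * mu s ^+ 2) ->
  Prob sample (fun Rs => r%:R * eps * M / 2 < `|\sum_(v <- Rs) wt v - r%:R * M|)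
  <= 4 / 30 * delta.
Proof.
move=> M0.
have n0 : 0 < n by rewrite ltr0n.
have r0 : 0 < r%:R :> R by rewrite ltr0n.
have muE : mu s = M * n by rewrite /mubar divfK ?gt_eqF.
have muM : mu s / n = M by [].
move: (M) M0 muE muM => m m0 muE muM.
rewrite ler_pdivrMr muE ?mulr_gt0 ?exprn_gt0 ?mulr_gt0 // => r_ge.
have t0 : 0 < r%:R * eps * m / 2 by rewrite !(divr_gt0, mulr_gt0).
have [u0 u1] := uniformV_probability.
rewrite -(ler_pM2l (exprn_gt0 2 t0)).
have := chebyshev_iid_sum r wt u0 u1 (ltW t0).
rewrite !expect_uniformV (sum_wt adj_sym) // muM => /le_trans; apply.
rewrite mulrA ler_pdivrMr //.
set S := \sum_v _ in r_ge *.
have {}r_ge : S * 30 <= r%:R * (eps ^+ 2 * delta * m ^+ 2) * n.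
  by rewrite -(ler_pM2l n0); lra.
by rewrite -(ler_pM2l r0) in r_ge; lra.
Qed.

(* The threshold is 5 / delta times the bound r * B / n on the mean of the sum. *)
Lemma Prob_sample_sum (f : V -> R) (B : R) : (forall v, 0 <= f v) -> 0 < B ->
    \sum_v f v <= B ->
  Prob sample (fun Rs => r%:R * (B / n) * 5 / delta < \sum_(v <- Rs) f v)
  <= delta / 5.
Proof.
move=> f0 B0 fB.
have n0 : 0 < n by rewrite ltr0n.
have r0 : 0 < r%:R :> R by rewrite ltr0n.
have [u0 u1] := uniformV_probability.
set t := _ / delta.
have t0 : 0 < t by rewrite !(divr_gt0, mulr_gt0).
rewrite -(ler_pM2l t0).
apply: (@le_trans _ _ (expect sample (fun Rs => \sum_(v <- Rs) f v))).
  apply: markov => [|Rs|Rs /ltW //]; first exact: sample_nonneg.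
  by apply: sumr_ge0.
rewrite expect_iid_sum // expect_uniformV.
rewrite (_ : t * _ = r%:R * (B / n)); last by rewrite /t; field; rewrite !gt_eqF.
by rewrite ler_wpM2l ?ler_pM2r ?invr_gt0 // ltW.
Qed.

Lemma wt2_ge0 v : 0 <= wt2 v.
Proof. by apply: sumr_ge0 => u _; apply: sqr_ge0. Qed.

Lemma sampleX_probability (Rs : seq V) :
  \sum_(v <- Rs) (deg v)%:R != 0 :> R ->
  is_probability (sampleX adj ident s Rs).
Proof.
move=> D0; split.
  apply: nonneg_lbind => [|v]; first by apply: nonneg_draw => v; apply: ler0n.
  apply: nonneg_lbind => [|u]; last by rewrite /nonneg /= ler01.
  by apply: nonneg_draw => u; apply: ler01.
(* The mass is the expectation of the constant 1, whose numerator counts neighbours and so equals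
   the total degree. *)
have := expect_sampleX adj ident s Rs (fun=> 1).
rewrite /expect; under eq_bigr do rewrite mulr1.
rewrite -/(mass _) => ->.
under [X in X / _]eq_bigr do rewrite sumr_const.
by rewrite divff.
Qed.

(** With the sample fixed, the estimate has mean [W / r], which is within half of the tolerance of
    [m]. A full deviation thus forces the other half on the [q] draws, to which Chebyshev
    applies. *)
Lemma Prob_estimate (Rs : seq V) (m : R) (D := \sum_(v <- Rs) (deg v)%:R : R) :
    0 < m -> D != 0 ->
    `|\sum_(v <- Rs) wt v - r%:R * m| <= r%:R * eps * m / 2 ->
  (eps * m * r%:R) ^+ 2 * q%:R *
  Prob (iid q (sampleX adj ident s Rs))
    (fun Xs => eps * m < `|1 / r%:R * (D / q%:R) * (\sum_(X <- Xs) X) - m|) <=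
  4 * D * \sum_(v <- Rs) wt2 v.
Proof.
move=> m0 D0 W.
have Dgt0 : 0 < D by rewrite lt_def D0 sumr_ge0 // => v _; rewrite ler0n.
have r0 : 0 < r%:R :> R by rewrite ltr0n.
have q0 : 0 < q%:R :> R by rewrite ltr0n.
have [p0 p1] := sampleX_probability D0.
(* A deviation [t] of the sum of the [X_i], scaled by [D / (r * q)], is exactly [eps * m / 2]. *)
pose t := eps * m * r%:R * q%:R / (2 * D).
have t0 : 0 <= t by rewrite ltW // !(divr_gt0, mulr_gt0).
have := chebyshev_iid_sum q id p0 p1 t0.
rewrite !expect_sampleX -/D -/(\sum_(v <- Rs) wt v) -/(\sum_(v <- Rs) wt2 v).
set P := Prob _ _ => h; set P' := Prob _ _.
have le_P : P' <= P.
  rewrite /P /P' !ProbE; apply: ler_expect => [|Xs]; first exact: nonneg_iid.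
  case: ltP => [far|_]; last by rewrite ler0n.
  rewrite ler1n lt0b.
  set S := \sum_(X <- Xs) X in far *; set w := \sum_(v <- Rs) _ in W *.
  (* The error splits into the fluctuation of the draws and the bias of the sample. *)
  have E : 1 / r%:R * (D / q%:R) * S - m =
      (D / q%:R * (S - q%:R * (w / D)) + (w - r%:R * m)) / r%:R.
    by field; rewrite D0 !gt_eqF.
  move: far; rewrite E normrM (gtr0_norm (x := r%:R^-1)) ?invr_gt0 //.
  rewrite ltr_pdivlMr // => far.
  have : eps * m * r%:R / 2 < `|D / q%:R * (S - q%:R * (w / D))|.
    by have := lt_le_trans far (ler_normD _ _); lra.
  rewrite normrM (gtr0_norm (x := D / _)) ?divr_gt0 //.
  rewrite mulrC -ltr_pdivrMl ?divr_gt0 // => /le_lt_trans; apply.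
  by rewrite le_eqVlt; apply/orP; left; apply/eqP; rewrite /t; field;
     rewrite D0 !gt_eqF.
set Q := \sum_(v <- Rs) wt2 v in h *.
have -> : (eps * m * r%:R) ^+ 2 * q%:R * P' = 4 * D ^+ 2 / q%:R * (t ^+ 2 * P').
  by rewrite /t; field; rewrite D0 !gt_eqF.
have -> : 4 * D * Q = 4 * D ^+ 2 / q%:R * (q%:R * (Q / D)).
  by field; rewrite D0 !gt_eqF.
rewrite ler_wpM2l ?divr_ge0 ?mulr_ge0 ?sqr_ge0 ?ler0n ?(ltW Dgt0) //.
by apply: le_trans _ h; rewrite ler_wpM2l ?sqr_ge0.
Qed.

(** * Using the lower bounds on [r] and [q]; union bound *)

Hypothesis r_ge :
  r%:R >= 30 * n * (\sum_v wt v ^+ 2) / (eps ^+ 2 * delta * mu s ^+ 2).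
Hypothesis q_ge : q%:R >= 2000 * #|edges adj|%:R * mu (2 * s - 1)
                          / (eps ^+ 2 * delta ^+ 3 * mu s ^+ 2).

(** [degB] and [wt2B] bound the sums of [deg] and [wt2] over all vertices, by [sum_deg_le] and
    [sum_wt_pair_sqr]. *)
Let degB : R := 2 * #|edges adj|%:R.
Let wt2B : R := 2 * mu (2 * s - 1).

Lemma Prob_estimate_far (Rs : seq V) (D := \sum_(v <- Rs) (deg v)%:R : R) :
    0 < M -> D != 0 ->
    `|\sum_(v <- Rs) wt v - r%:R * M| <= r%:R * eps * M / 2 ->
    D <= r%:R * (degB / n) * 5 / delta ->
    \sum_(v <- Rs) wt2 v <= r%:R * (wt2B / n) * 5 / delta ->
  Prob (iid q (sampleX adj ident s Rs))
    (fun Xs => eps * M < `|1 / r%:R * (D / q%:R) * (\sum_(X <- Xs) X) - M|)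
  <= delta / 5.
Proof.
move=> M0 D0 W; have := Prob_estimate M0 D0 W.
have n0 : 0 < n by rewrite ltr0n.
have r0 : 0 < r%:R :> R by rewrite ltr0n.
have q0 : 0 < q%:R :> R by rewrite ltr0n.
have muE : mu s = M * n by rewrite /mubar divfK ?gt_eqF.
set P := Prob _ _; rewrite -/D; set Q := \sum_(v <- Rs) wt2 v => h hD hQ.
move: q_ge h; clearbody P; rewrite muE.
move: (M) M0 => m m0.
rewrite ler_pdivrMr ?mulr_gt0 ?exprn_gt0 ?mulr_gt0 // => qB h.
have C0 : 0 < (eps * m * r%:R) ^+ 2 * q%:R by rewrite !(exprn_gt0, mulr_gt0).
rewrite -(ler_pM2l C0); apply: le_trans h _.
have Dge0 : 0 <= D by apply: sumr_ge0 => v _; apply: ler0n.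
have Qge0 : 0 <= Q by apply: sumr_ge0 => v _; apply: wt2_ge0.
apply: (le_trans (_ : _ <= 4 * ((r%:R * (degB / n) * 5 / delta) *
                             (r%:R * (wt2B / n) * 5 / delta)))).
  by rewrite -mulrA ler_wpM2l // ler_pM.
(* Here 2000 is [4 * (2 * 5) * (2 * 5) * 5]: the two thresholds give the factors 10 and
   [delta ^- 2], while the target [delta / 5] gives the last 5 and the third power of [delta]. *)
have -> : 4 * ((r%:R * (degB / n) * 5 / delta) * (r%:R * (wt2B / n) * 5 / delta))
   = (2000 * #|edges adj|%:R * mu (2 * s - 1)) * (r%:R ^+ 2 / (5 * n ^+ 2 * delta ^+ 2)).
  by rewrite /degB /wt2B; field; rewrite !gt_eqF.
have -> : (eps * m * r%:R) ^+ 2 * q%:R * (delta / 5) =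
    (q%:R * (eps ^+ 2 * delta ^+ 3 * (m * n) ^+ 2)) *
    (r%:R ^+ 2 / (5 * n ^+ 2 * delta ^+ 2)).
  by field; rewrite !gt_eqF.
by rewrite ler_wpM2r // ltW // !(divr_gt0, mulr_gt0, exprn_gt0).
Qed.

Lemma sum_wt_deg0 (Rs : seq V) :
  \sum_(v <- Rs) (deg v)%:R == 0 :> R -> \sum_(v <- Rs) wt v = 0.
Proof.
rewrite psumr_eq0 => [/allP D0|v _]; last exact: ler0n.
apply: big1_seq => v /D0; rewrite pnatr_eq0 cards_eq0 => /eqP nv.
by rewrite /Defs.wt nv big_set0.
Qed.

Lemma Prob_approx_far : (exists v, deg v != 0%N) ->
  Prob (approx adj ident s r q) (fun X => eps * M < `|X - M|) <= delta.
Proof.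
move=> dV.
have n0 : 0 < n by rewrite ltr0n.
have r0 : 0 < r%:R :> R by rewrite ltr0n.
have s1 := s_ge1; have s0 : 0 < s by lra.
have s20 : 0 < 2 * s - 1 by lra.
have M0 : 0 < M := divr_gt0 (mu_gt0 s0 dV) n0.
have wt2B0 : 0 < wt2B by rewrite mulr_gt0 // (mu_gt0 s20 dV).
have degB0 : 0 < degB.
  apply: lt_le_trans (sum_deg_le R adj_sym adj_irr ident_inj).
  rewrite lt_def psumr_eq0 => [|v _]; last exact: ler0n.
  rewrite sumr_ge0 ?andbT => [|v _]; last exact: ler0n.
  apply/allPn; case: dV => v dv; exists v; first exact: mem_index_enum.
  by rewrite pnatr_eq0.
have PW := Prob_sample_wt M0 r_ge.
have PD := Prob_sample_sum (fun v => ler0n R (deg v)) degB0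
  (sum_deg_le R adj_sym adj_irr ident_inj).
have PQ := Prob_sample_sum wt2_ge0 wt2B0 (sum_wt_pair_sqr adj_sym adj_irr ident_inj s_ge1).
move: PW PD PQ; rewrite !ProbE.
set fW := fun Rs : seq V => _; set fD := fun Rs : seq V => _.
set fQ := fun Rs : seq V => _ => PW PD PQ.
rewrite /approx expect_lbind.
(* Union bound, sample by sample: if a bad event occurs its indicator 1 already dominates the
   conditional probability; otherwise [Prob_estimate_far] gives [delta / 5]. *)
apply: (@le_trans _ _ (expect sample (fun Rs => fW Rs + (fD Rs + (fQ Rs + delta / 5))))).
  apply: ler_expect => [|Rs]; first exact: sample_nonneg.
  rewrite /fW /fD /fQ.
  set w := \sum_(v <- Rs) wt v; set D := \sum_(v <- Rs) (deg v)%:R.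
  set Q := \sum_(v <- Rs) wt2 v.
  have d5 : 0 <= delta / 5 by rewrite divr_ge0 // ltW.
  (* With [D = 0] the output and the total weight are both 0. Missing [M] then means [eps * M < M],
     and the weight event [fW] occurs as well. *)
  have [D0|D0] := eqVneq D 0.
    rewrite expect_lret /w sum_wt_deg0 ?D0 //; last exact/eqP.
    have rM0 := mulr_gt0 r0 M0.
    rewrite !sub0r !normrN (gtr0_norm M0) (gtr0_norm rM0).
    have : eps * M < M -> r%:R * eps * M / 2 < r%:R * M.
      rewrite -(ltr_pM2l r0) => h; lra.
    case: (ltP (eps * M)) => [_ /(_ isT) ->|_ _]; first by rewrite lerDl !addr_ge0.
    by rewrite !addr_ge0.
  rewrite expect_lbind.
  under eq_expect do rewrite expect_lret; rewrite -ProbE.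
  have [p0 p1] := sampleX_probability D0.
  set P := Prob _ _.
  have P1 : P <= 1 by apply: Prob_le1; split; [exact: nonneg_iid | exact: mass_iid].
  have [W|W] := ltP; first by apply: le_trans P1 _; rewrite lerDl !addr_ge0.
  have [hD|hD] := ltP.
    by apply: le_trans P1 _; rewrite add0r lerDl addr_ge0.
  have [hQ|hQ] := ltP; first by apply: le_trans P1 _; rewrite !add0r lerDl.
  by rewrite !add0r; apply: Prob_estimate_far.
(* The total is [4 / 30 + 3 / 5] times [delta], which is below [delta]. *)
rewrite !expectD expect_cst; first by have := delta_gt0; lra.
by apply: mass_iid; case: uniformV_probability.
Qed.

End Sampling.

(** * Passing to the complementary event, and edgeless graphs *)

Theorem mainTheorem5 (R : realType) (V : finType) (adj : rel V)
    (adj_sym : symmetric adj) (adj_irr : irreflexive adj)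
    (ident : V -> nat) (ident_inj : injective ident)
    (V_gt0 : (0 < #|V|)%N)
    (s eps delta : R) (s_ge1 : 1 <= s) (eps_gt0 : 0 < eps)
    (delta_gt0 : 0 < delta) (delta_lt1 : delta < 1)
    (r q : nat) (r_gt0 : (0 < r)%N) (q_gt0 : (0 < q)%N)
    (r_ge : r%:R >= 30 * #|V|%:R * (\sum_(v : V) wt adj ident s v ^+ 2)
                    / (eps ^+ 2 * delta * mu adj s ^+ 2))
    (q_ge : q%:R >= 2000 * #|edges adj|%:R * mu adj (2 * s - 1)
                    / (eps ^+ 2 * delta ^+ 3 * mu adj s ^+ 2)) :
  1 - delta <=
  Prob (approx adj ident s r q)
       (fun X => (1 - eps) * mubar adj s <= X <= (1 + eps) * mubar adj s).
Proof.
have [a0 a1] := approx_probability adj ident s r q V_gt0.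
set A := fun X : R => _.
rewrite lerBlDr addrC -lerBlDr -a1 -ProbC.
have [/existsP dV|dV] := boolP [exists v, deg adj v != 0%N].
  apply: le_trans _ (Prob_approx_far adj_sym adj_irr ident_inj s_ge1 eps_gt0
    delta_gt0 V_gt0 r_gt0 q_gt0 r_ge q_ge dV).
  rewrite !ProbE; apply: ler_expect => // X /=; rewrite ler_nat.
  rewrite (_ : A X = (`|X - mubar adj s| <= eps * mubar adj s)) -?ltNge //.
  by rewrite ler_distl /A mulrBl mulrDl mul1r.
(* Without edges [mubar] is 0, so the target interval is the point 0; every sample has total degree
   0 and the output is always 0. *)
have deg0 v : deg adj v = 0%N.
  by apply/eqP; move: dV; rewrite negb_exists => /forallP/(_ v); rewrite negbK.
have mubar0 : mubar adj s = 0.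
  by rewrite /mubar /mu big1 ?mul0r // => v _; rewrite deg0 powR0 //; lra.
rewrite ProbC a1 ProbE /approx expect_lbind.
rewrite (@eq_expect _ _ _ _ (fun=> 1)) => [|Rs]; last first.
  by rewrite big1 ?eqxx ?expect_lret /A ?mubar0 ?mulr0 ?lexx // => v _; rewrite deg0.
rewrite expect_cst; first by rewrite subrr ltW.
by rewrite mass_iid // mass_uniform // -cardE.
Qed.
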